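(* Let $\mathbb{F}$ be a field and let $\mathcal{M}$ be a conditional oriented matroid on a finite ground set $\mathcal{I}$. The assignments $y_i^+ \mapsto h_i^+$, $y_i^- \mapsto h_i^-$, and $z_i \mapsto 1 - h_i^+ - h_i^-$ ($i \in \mathcal{I}$) give an identification of $\mathbb{F}$-algebras $$\mathbb{F}[\mathcal{Z}_{\mathcal{M}}] = \widehat{S}/\mathbf{I}(\mathcal{Z}_{\mathcal{M}}) \cong \widehat{\mathrm{VG}}_{\mathcal{M}}.$$ This induces the identification of associated graded rings $$\mathbf{R}(\mathcal{Z}_{\mathcal{M}}) = \widehat{S}/\mathrm{gr}\,\mathbf{I}(\mathcal{Z}_{\mathcal{M}}) \cong \widehat{\mathcal{VG}}_{\mathcal{M}}.$$
   Context: **Conditional oriented matroids.** Let $\mathcal{I}$ be a finite set. A signed subset of $\mathcal{I}$ is a function $X : \mathcal{I} \to \{+,-,0\}$; $-X$ is obtained by exchanging $+$ and $-$. For signed subsets $X, Y$: $\mathrm{Sep}(X,Y) = \{i : X(i) = -Y(i) \neq 0\}$, and $(X \circ Y)(i) = X(i)$ if $X(i) \neq 0$, $(X\circ Y)(i) = Y(i)$ otherwise. A conditional oriented matroid on $\mathcal{I}$ is a family $\mathcal{M}$ of signed subsets of $\mathcal{I}$ (called covectors) such that (Face Symmetry) $X, Y \in \mathcal{M}$ implies $X \circ (-Y) \in \mathcal{M}$; and (Strong Elimination) if $X,Y \in \mathcal{M}$ and $i \in \mathrm{Sep}(X,Y)$, there is $Z \in \mathcal{M}$ with $Z(i) = 0$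 and $Z(j) = (X\circ Y)(j)$ for all $j \in \mathcal{I} - \mathrm{Sep}(X,Y)$. **Big VG rings.** $\widehat{\mathrm{VG}}_{\mathcal{M}}$ is the $\mathbb{F}$-algebra of functions $\mathcal{M} \to \mathbb{F}$ with pointwise operations. The Heaviside functions are $h_i^{s}(X) = 1$ if $X(i) = s$ and $0$ otherwise ($X \in \mathcal{M}$, $i \in \mathcal{I}$, $s \in \{+,-\}$). Let $F_k \subseteq \widehat{\mathrm{VG}}_{\mathcal{M}}$ be the set of polynomials of degree $\leq k$ in the $h_i^\pm$, with $F_{-1}=0$. The graded big Varchenko--Gelfand ring is $\widehat{\mathcal{VG}}_{\mathcal{M}} = \bigoplus_{k \geq 0} F_k/F_{k-1}$. **Orbit harmonics and the big locus.** For a finite set $\mathcal{Z} \subseteq \mathbb{F}^N$ with coordinate ring $R$ (polynomial ring in $N$ variables), $\mathbb{F}[\mathcal{Z}]$ is the algebra of functions $\mathcal{Z} \to \mathbb{F}$; $\mathbf{I}(\mathcal{Z}) \subseteq R$ is the ideal of polynomials vanishing on $\mathcal{Z}$; $\mathrm{gr}\,\mathbf{I}(\mathcal{Z})$ is the ideal generated by the top-degree homogeneous components of nonzero $f \in \mathbf{I}(\mathcal{Z})$; and $\mathbf{R}(\mathcal{Z}) = R/\mathrm{gr}\,\mathbf{I}(\mathcal{Z})$, a graded algebra. The big locus is $\mathcal{Z}_{\mathcal{M}} = \{\mathbf{z}_X : X \in \mathcal{M}\} \subseteq \mathbb{F}^{\mathcal{I} \times \{+,-,0\}}$, where $(\mathbf{z}_X)_{i,s}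 = 1$ if $X(i) = s$ and $0$ otherwise; the coordinate ring of $\mathbb{F}^{\mathcal{I} \times \{+,-,0\}}$ is $\widehat{S} = \mathbb{F}[y_i^+,y_i^-,z_i : i \in \mathcal{I}]$, with $y_i^+,y_i^-,z_i$ the coordinates indexed by $(i,+),(i,-),(i,0)$. *)

(* Defs.v *)
From HB Require Import structures.
From mathcomp Require Import all_boot all_order all_algebra.
From mathcomp Require Import finmap boolp.
From mathcomp.multinomials Require Import mpoly.

Set Implicit Arguments.
Unset Strict Implicit.
Unset Printing Implicit Defensive.

Import GRing.Theory.
Local Open Scope ring_scope.

(* Commutative unital algebras over [K] in which 1 = 0 is allowed: the comAlgType
   of ssralg excludes the zero ring, which occurs here when the oriented matroid
   has no covectors. Scalars enter through the structure morphism K -> A. *)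
HB.mixin Record isPzComAlg (K : pzRingType) A of GRing.ComPzRing A := {
  alg_scalar : K -> A;
  alg_scalar_zmod : zmod_morphism alg_scalar;
  alg_scalar_monoid : monoid_morphism alg_scalar
}.
#[short(type="pzComAlgType")]
HB.structure Definition PzComAlg (K : pzRingType) :=
  {A of GRing.ComPzRing A & isPzComAlg K A}.
Arguments alg_scalar {K s} c.

HB.instance Definition _ (K : pzRingType) (A : pzComAlgType K) :=
  GRing.isZmodMorphism.Build K A alg_scalar alg_scalar_zmod.
HB.instance Definition _ (K : pzRingType) (A : pzComAlgType K) :=
  GRing.isMonoidMorphism.Build K A alg_scalar alg_scalar_monoid.

Definition alg_iso (K : pzRingType) (A B : pzComAlgType K) (f : A -> B) : Prop :=
  [/\ zmod_morphism f, monoid_morphism f, forall c : K, f (alg_scalar c) = alg_scalar c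
    & bijective f].

HB.instance Definition _ (K : comNzRingType) n :=
  isPzComAlg.Build K {mpoly K[n]} (raddfB (@mpolyC n K)) (rmorphism_monoidP (@mpolyC n K)).

Definition fun_alg (K : comPzRingType) (T : finType) : Type := {ffun T -> K}.

Section FunAlg.
Variables (K : comPzRingType) (T : finType).

HB.instance Definition _ := GRing.PzRing.on (fun_alg K T).

Fact fun_alg_mulC : @commutative (fun_alg K T) _ *%R.
Proof. by move=> f g; apply/ffunP => x; rewrite !ffunE mulrC. Qed.
HB.instance Definition _ :=
  GRing.PzRing_hasCommutativeMul.Build (fun_alg K T) fun_alg_mulC.

Definition fun_of_alg (f : fun_alg K T) : T -> K := fun_of_fin f.
Definition alg_of_fun (f : T -> K) : fun_alg K T := [ffun x => f x].

Fact fun_alg_scalar_zmod : zmod_morphism (fun c : K => alg_of_fun (fun => c)).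
Proof. by move=> c d; apply/ffunP => x; rewrite !ffunE. Qed.
Fact fun_alg_scalar_monoid : monoid_morphism (fun c : K => alg_of_fun (fun => c)).
Proof. by split=> [|c d]; apply/ffunP => x; rewrite !ffunE. Qed.
HB.instance Definition _ :=
  isPzComAlg.Build K (fun_alg K T) fun_alg_scalar_zmod fun_alg_scalar_monoid.

End FunAlg.
Coercion fun_of_alg : fun_alg >-> Funclass.

(* Unlike idealr in ring_quotient, ideals are allowed to be improper. *)

HB.mixin Record isIdeal (A : comPzRingType) (S : A -> bool) := {
  ideal_mull : forall a u, S u -> S (a * u)
}.
#[short(type="idealType")]
HB.structure Definition Ideal (A : comPzRingType) :=
  {S of GRing.ZmodClosed A S & isIdeal A S}.

Section QuotClass.
Variables (V : zmodType) (W : zmodClosed V).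
Local Open Scope quotient_scope.

Definition quot_class (x : V) : Quotient.quot W := \pi_(Quotient.quot W) x.

Lemma quot_class_eq x y : (quot_class x = quot_class y) <-> (x - y \in W).
Proof. by rewrite Quotient.idealrBE; split => [/eqP|/eqP]. Qed.

Fact quot_class_zmod : zmod_morphism quot_class.
Proof. exact: (raddfB \pi_(Quotient.quot W)). Qed.
HB.instance Definition _ := GRing.isZmodMorphism.Build V (Quotient.quot W) quot_class quot_class_zmod.

Lemma quot_reprK : cancel (fun u : Quotient.quot W => repr u) quot_class.
Proof. exact: reprK. Qed.

Lemma quot_class_repr x : repr (quot_class x) - x \in W.
Proof. by apply/quot_class_eq; rewrite quot_reprK. Qed.

End QuotClass.

Definition quotalg (A : comPzRingType) (J : idealType A) : Type := Quotient.quot J.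

Section QuotAlg.
Variables (A : comPzRingType) (J : idealType A).
Local Notation Q := (quotalg J).

HB.instance Definition _ := GRing.Zmodule.on Q.

Definition quotalg_class (x : A) : Q := quot_class J x.
Local Notation cls := quotalg_class.

Definition quotalg_one : Q := cls 1.
Definition quotalg_mul (u v : Q) : Q :=
  cls (repr (u : Quotient.quot J) * repr (v : Quotient.quot J)).

Lemma quotalg_mulE x y : quotalg_mul (cls x) (cls y) = cls (x * y).
Proof.
apply/quot_class_eq; set x' := repr _; set y' := repr _.
have -> : x' * y' - x * y = y' * (x' - x) + x * (y' - y).
  by rewrite !mulrBr addrA [y' * x']mulrC [y' * x]mulrC subrK.
by rewrite rpredD //; apply: ideal_mull; exact: quot_class_repr.
Qed.

Lemma quotalg_ind (P : Q -> Prop) : (forall x, P (cls x)) -> forall u, P u.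
Proof. by move=> Pc u; rewrite -[u](@quot_reprK A J); apply: Pc. Qed.

Fact quotalg_class_zmod : zmod_morphism cls.
Proof. exact: quot_class_zmod. Qed.
HB.instance Definition _ := GRing.isZmodMorphism.Build A Q cls quotalg_class_zmod.

Fact quotalg_mulA : associative quotalg_mul.
Proof.
elim/quotalg_ind => x; elim/quotalg_ind => y; elim/quotalg_ind => z.
by rewrite !quotalg_mulE mulrA.
Qed.
Fact quotalg_mulC : commutative quotalg_mul.
Proof.
by elim/quotalg_ind => x; elim/quotalg_ind => y; rewrite !quotalg_mulE mulrC.
Qed.
Fact quotalg_mul1 : left_id quotalg_one quotalg_mul.
Proof. by elim/quotalg_ind => x; rewrite quotalg_mulE mul1r. Qed.
Fact quotalg_mulDl : left_distributive quotalg_mul +%R.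
Proof.
elim/quotalg_ind => x; elim/quotalg_ind => y; elim/quotalg_ind => z.
by rewrite -raddfD !quotalg_mulE -raddfD mulrDl.
Qed.
HB.instance Definition _ := GRing.Zmodule_isComPzRing.Build Q
  quotalg_mulA quotalg_mulC quotalg_mul1 quotalg_mulDl.

Fact quotalg_class_monoid : monoid_morphism cls.
Proof. by split=> // x y; rewrite -quotalg_mulE. Qed.
HB.instance Definition _ := GRing.isMonoidMorphism.Build A Q cls quotalg_class_monoid.

End QuotAlg.

Section QuotScalar.
Variables (K : pzRingType) (A : pzComAlgType K) (J : idealType A).

Fact quotalg_scalar_zmod : zmod_morphism (fun c : K => quotalg_class J (alg_scalar c)).
Proof. by move=> c d; rewrite !raddfB. Qed.
Fact quotalg_scalar_monoid : monoid_morphism (fun c : K => quotalg_class J (alg_scalar c)).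
Proof. by split=> [|c d]; rewrite ?rmorph1 ?rmorphM. Qed.
HB.instance Definition _ :=
  isPzComAlg.Build K (quotalg J) quotalg_scalar_zmod quotalg_scalar_monoid.

End QuotScalar.

Section GeneratedIdeal.
Variables (A : comPzRingType) (G : A -> Prop).

Definition gen_ideal : {pred A} := fun f =>
  `[< exists2 s : seq (A * A), (forall g, g \in s -> G g.2)
        & f = \sum_(g <- s) g.1 * g.2 >].

Fact gen_ideal_mull a u : gen_ideal u -> gen_ideal (a * u).
Proof.
move=> /asboolP[s Gs ->]; apply/asboolP.
exists [seq (a * g.1, g.2) | g <- s]; first by move=> _ /mapP[g sg ->]; exact: (Gs g sg).
by rewrite big_map mulr_sumr; apply: eq_bigr => g _; rewrite mulrA.
Qed.

Fact gen_ideal_zmod : zmod_closed gen_ideal.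
Proof.
split; first by apply/asboolP; exists [::]; rewrite ?big_nil.
move=> u v /asboolP[s Gs ->] /(gen_ideal_mull (-1)) /asboolP[t Gt tE].
apply/asboolP; exists (s ++ t); last by rewrite big_cat -tE mulN1r.
by move=> g; rewrite mem_cat => /orP[/Gs|/Gt].
Qed.
HB.instance Definition _ := GRing.isZmodClosed.Build A gen_ideal gen_ideal_zmod.
HB.instance Definition _ := isIdeal.Build A gen_ideal gen_ideal_mull.

End GeneratedIdeal.

Record dsum (V : nat -> zmodType) : Type := DSum {
  dsum_val :> forall k, V k;
  dsum_fin : exists N, forall k, (N <= k)%N -> dsum_val k = 0
}.

Section DSum.
Variable V : nat -> zmodType.
Local Notation D := (dsum V).

HB.instance Definition _ := gen_eqMixin D.
HB.instance Definition _ := gen_choiceMixin D.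

Lemma dsumP (x y : D) : (forall k, x k = y k) -> x = y.
Proof.
case: x y => [x fx] [y fy] /= xy; have {xy}xy : x = y by exact: functional_extensionality_dep.
by case: _ / xy fy => fy; congr DSum; exact: Prop_irrelevance.
Qed.

Fact dsum_zero_fin : exists N, forall k, (N <= k)%N -> (0 : V k) = 0.
Proof. by exists 0%N. Qed.
Definition dsum_zero : D := DSum dsum_zero_fin.

Fact dsum_opp_fin (x : D) : exists N, forall k, (N <= k)%N -> - x k = 0.
Proof. by case: (dsum_fin x) => N xN; exists N => k /xN ->; rewrite oppr0. Qed.
Definition dsum_opp (x : D) : D := DSum (dsum_opp_fin x).

Fact dsum_add_fin (x y : D) : exists N, forall k, (N <= k)%N -> x k + y k = 0.
Proof.
case: (dsum_fin x) (dsum_fin y) => N xN [N' yN']; exists (maxn N N') => k.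
by rewrite geq_max => /andP[/xN -> /yN' ->]; rewrite addr0.
Qed.
Definition dsum_add (x y : D) : D := DSum (dsum_add_fin x y).

Fact dsum_addA : associative dsum_add.
Proof. by move=> x y z; apply: dsumP => k; exact: addrA. Qed.
Fact dsum_addC : commutative dsum_add.
Proof. by move=> x y; apply: dsumP => k; exact: addrC. Qed.
Fact dsum_add0 : left_id dsum_zero dsum_add.
Proof. by move=> x; apply: dsumP => k; exact: add0r. Qed.
Fact dsum_addN : left_inverse dsum_zero dsum_opp dsum_add.
Proof. by move=> x; apply: dsumP => k; exact: addNr. Qed.
HB.instance Definition _ := GRing.isZmodule.Build D
  dsum_addA dsum_addC dsum_add0 dsum_addN.

Definition in_summand (k : nat) (x : D) : Prop := forall j, j != k -> x j = 0.

End DSum.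

Record filtration (K : pzRingType) (A : pzComAlgType K) := Filtration {
  fil : nat -> {pred A};
  fil_zmod : forall k, zmod_closed (fil k);
  filS : forall k, {subset fil k <= fil k.+1};
  fil_scalar : forall c : K, alg_scalar c \in fil 0;
  filM : forall j k a b, a \in fil j -> b \in fil k -> a * b \in fil (j + k)
}.

Section AssociatedGraded.
Variables (K : pzRingType) (A : pzComAlgType K) (F : filtration A).

HB.instance Definition _ k :=
  GRing.isZmodClosed.Build A (fil F k) (fil_zmod F k).

(* F_k as an additive group. *)
Record filmod (k : nat) : Type := FilMod { filmod_val : A; _ : filmod_val \in fil F k }.
HB.instance Definition _ k := [isSub for @filmod_val k].
HB.instance Definition _ k := [Choice of filmod k by <:].
HB.instance Definition _ k := [SubChoice_isSubZmodule of filmod k by <:].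

(* F_(k-1), with F_(-1) = 0. *)
Definition fil_pred (k : nat) : {pred A} :=
  if k is j.+1 then fil F j else pred1 0.

Fact fil_pred_zmod k : zmod_closed (fil_pred k).
Proof.
case: k => [|k]; last exact: fil_zmod.
by split=> [|u v]; rewrite !inE // => /eqP-> /eqP->; rewrite subr0.
Qed.
HB.instance Definition _ k := GRing.isZmodClosed.Build A (fil_pred k) (fil_pred_zmod k).

Definition fil_sub (k : nat) : {pred filmod k} := fun x => val x \in fil_pred k.

Fact fil_sub_zmod k : zmod_closed (@fil_sub k).
Proof.
have E x : (x \in @fil_sub k) = (val x \in fil_pred k) by [].
by split=> [|u v]; rewrite !E ?raddf0 ?rpred0 // raddfB; exact: rpredB.
Qed.
HB.instance Definition _ k :=
  GRing.isZmodClosed.Build (filmod k) (@fil_sub k) (@fil_sub_zmod k).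

(* F_k / F_(k-1). *)
Definition gr_piece (k : nat) : zmodType := Quotient.quot (@fil_sub k).

Definition gr : Type := dsum gr_piece.
HB.instance Definition _ := GRing.Zmodule.on gr.
Definition gr_val (x : gr) : forall k, gr_piece k := dsum_val x.
Coercion gr_val : gr >-> Funclass.

(* The class of [a] in F_k / F_(k-1), for [a] in F_k (junk value 0 otherwise). *)
Definition gr_cls (k : nat) (a : A) : gr_piece k := quot_class (@fil_sub k) (insubd 0 a).
Definition gr_rep (k : nat) (u : gr_piece k) : A := val (repr u).

Lemma fil1 : 1 \in fil F 0.
Proof. by rewrite -(rmorph1 (@alg_scalar K A)) fil_scalar. Qed.

Lemma gr_repP k (u : gr_piece k) : gr_rep u \in fil F k.
Proof. exact: valP. Qed.

Lemma gr_repK k : cancel (@gr_rep k) (@gr_cls k).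
Proof. by move=> u; rewrite /gr_cls /gr_rep valKd quot_reprK. Qed.

Lemma gr_cls_eq k a b : a \in fil F k -> b \in fil F k ->
  gr_cls k a = gr_cls k b <-> a - b \in fil_pred k.
Proof.
move=> ak bk; rewrite quot_class_eq -[X in X <-> _]/(is_true (fil_sub _)).
by rewrite /fil_sub raddfB /= !insubdK.
Qed.

Lemma gr_clsB k a b : a \in fil F k -> b \in fil F k ->
  gr_cls k (a - b) = gr_cls k a - gr_cls k b.
Proof.
move=> ak bk; rewrite /gr_cls -raddfB; congr quot_class; apply: val_inj.
by rewrite raddfB /= !insubdK // rpredB.
Qed.

Lemma gr_cls0 k : gr_cls k 0 = 0.
Proof.
rewrite /gr_cls (_ : insubd 0 0 = 0) ?raddf0 //.
by apply: val_inj; rewrite /= insubdK ?rpred0.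
Qed.

Lemma gr_clsD k a b : a \in fil F k -> b \in fil F k ->
  gr_cls k (a + b) = gr_cls k a + gr_cls k b.
Proof.
move=> ak bk; rewrite -[b in LHS]opprK gr_clsB ?rpredN //.
by rewrite -[- b]sub0r gr_clsB ?rpred0 // gr_cls0 sub0r opprK.
Qed.

Lemma fil_predM j k a b :
  a \in fil_pred j -> b \in fil F k -> a * b \in fil_pred (j + k).
Proof.
case: j => [|j]; last exact: filM.
by rewrite inE => /eqP -> _; rewrite mul0r rpred0.
Qed.

Definition conv (a b : nat -> A) (k : nat) : A := \sum_(i < k.+1) a i * b (k - i)%N.

(* Multiplication is determined by (a + F_(i-1)) (b + F_(j-1)) = ab + F_(i+j-1)
   for a in F_i, b in F_j: see [gr_homM] below. *)
Definition gr_mul_val (x y : gr) (k : nat) : gr_piece k :=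
  gr_cls k (conv (fun i => gr_rep (x i)) (fun i => gr_rep (y i)) k).

Definition gr_lifts (a : nat -> A) (x : forall k, gr_piece k) : Prop :=
  forall k, a k \in fil F k /\ gr_cls k (a k) = x k.

Lemma gr_lifts_rep (x : gr) : gr_lifts (fun i => gr_rep (x i)) x.
Proof. by move=> k; rewrite gr_repP gr_repK. Qed.

Lemma conv_fil a b k : (forall i, a i \in fil F i) -> (forall i, b i \in fil F i) ->
  conv a b k \in fil F k.
Proof.
move=> aP bP; apply: rpred_sum => i _.
by have := filM (aP i) (bP (k - i)%N); rewrite subnKC ?leq_ord.
Qed.

Lemma gr_lifts_mul a b x y : gr_lifts a (gr_val x) -> gr_lifts b (gr_val y) ->
  gr_lifts (conv a b) (gr_mul_val x y).
Proof.
move=> ax bY k.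
have aP i : a i \in fil F i by case: (ax i).
have bP i : b i \in fil F i by case: (bY i).
have xP i : gr_rep (x i) \in fil F i by exact: gr_repP.
have yP i : gr_rep (y i) \in fil F i by exact: gr_repP.
split; first exact: conv_fil.
apply/gr_cls_eq; [exact: conv_fil | exact: conv_fil |].
rewrite /conv -sumrB; apply: rpred_sum => i _.
set a' := gr_rep (x i); set b' := gr_rep _.
have -> : a i * b (k - i)%N - a' * b' =
    (a i - a') * b (k - i)%N + (b (k - i)%N - b') * a'.
  by rewrite !mulrBl addrA [b _ * a']mulrC [b' * a']mulrC subrK.
have kE : k = (i + (k - i))%N by rewrite subnKC ?leq_ord.
have kE' : k = ((k - i) + i)%N by rewrite subnK ?leq_ord.
rewrite rpredD //.
  have := @fil_predM i (k - i)%N (a i - a') (b (k - i)%N); rewrite -kE; apply => //.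
  apply/gr_cls_eq; [by [] | exact: gr_repP |].
  case: (ax i) => _ ->; exact: esym (gr_repK _).
have := @fil_predM (k - i)%N i (b (k - i)%N - b') a'; rewrite -kE'; apply; last exact: gr_repP.
apply/gr_cls_eq; [by [] | exact: gr_repP |].
case: (bY (k - i)%N) => _ ->; exact: esym (gr_repK _).
Qed.

Fact gr_mul_fin x y : exists N, forall k, (N <= k)%N -> gr_mul_val x y k = 0.
Proof.
pose tr (x : gr) N i := if (i < N)%N then gr_rep (x i) else 0.
have trP (z : gr) : exists N, gr_lifts (tr z N) z.
  case: (dsum_fin z) => N zN; exists N => k; rewrite /tr; case: ltnP => [_|/zN zk].
    by rewrite gr_repP gr_repK.
  by rewrite rpred0 gr_cls0 /gr_val zk.
case: (trP x) (trP y) => N xN [N' yN']; exists (N + N')%N => k lek.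
case: (gr_lifts_mul xN yN' k) => _ <-; rewrite /conv big1 ?gr_cls0 // => i _.
rewrite /tr; case: ltnP => [iN|]; last by rewrite mul0r.
case: ltnP; last by rewrite mulr0.
rewrite ltn_subLR ?leq_ord // => kl; exfalso.
move: (leq_ltn_trans lek kl); rewrite ltn_add2r => /(ltn_trans iN).
by rewrite ltnn.
Qed.
Definition gr_mul (x y : gr) : gr := DSum (gr_mul_fin x y).

(* The element of the k-th summand given by the class of [a], for [a] in F_k. *)
Definition gr_hom_val (k : nat) (a : A) (j : nat) : gr_piece j :=
  if j == k then gr_cls j a else 0.
Fact gr_hom_fin k a : exists N, forall j, (N <= j)%N -> gr_hom_val k a j = 0.
Proof. by exists k.+1 => j kj; rewrite /gr_hom_val gtn_eqF. Qed.
Definition gr_hom (k : nat) (a : A) : gr := DSum (gr_hom_fin k a).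

Definition gr_one : gr := gr_hom 0 1.

Lemma gr_lifts_uniq a b (x y : gr) : gr_lifts a x -> gr_lifts b y ->
  (forall k, a k = b k) -> x = y.
Proof.
move=> ax bY ab; apply: dsumP => k; case: (ax k) (bY k) => _ + [_].
by rewrite /gr_val ab => <- <-.
Qed.

Lemma gr_lifts_add a b (x y : gr) : gr_lifts a x -> gr_lifts b y ->
  gr_lifts (fun k => a k + b k) (x + y : gr).
Proof.
move=> ax bY k; case: (ax k) (bY k) => aP ak [bP bk].
by rewrite rpredD // gr_clsD // ak bk.
Qed.

Lemma gr_lifts_hom k a : a \in fil F k ->
  gr_lifts (fun j => if j == k then a else 0) (gr_hom k a).
Proof.
move=> ak j; rewrite /gr_val /= /gr_hom_val.
by case: eqP => [->|_]; rewrite ?rpred0 ?gr_cls0.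
Qed.

Lemma convC a b k : conv a b k = conv b a k.
Proof.
rewrite /conv (reindex_inj rev_ord_inj) /=; apply: eq_bigr => i _.
by rewrite subSS subKn ?leq_ord // mulrC.
Qed.

Lemma convA a b c k : conv a (conv b c) k = conv (conv a b) c k.
Proof.
rewrite [RHS]convC /conv.
pose coef3 j l := a j * (b (k - j - l)%N * c l).
transitivity (\sum_(j < k.+1) \sum_(l < k.+1 | (l <= k - j)%N) coef3 j l).
  apply: eq_bigr => /= j _; rewrite -/(conv b c (k - j)) convC /conv mulr_sumr /=.
  rewrite (big_ord_narrow_leq (leq_subr _ _)) /=.
  by apply: eq_bigr => l _; rewrite /coef3 [c l * _]mulrC.
rewrite (exchange_big_dep predT) //=; apply: eq_bigr => l _.
transitivity (\sum_(j < k.+1 | (j <= k - l)%N) coef3 j l).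
  apply: eq_bigl => j; rewrite -ltnS -(ltnS j) -!subSn ?leq_ord //.
  by rewrite -subn_gt0 -(subn_gt0 j) -!subnDA addnC.
rewrite (big_ord_narrow_leq (leq_subr _ _)) mulr_sumr.
by apply: eq_bigr => j _; rewrite /coef3 -!subnDA addnC mulrA mulrC.
Qed.

Lemma conv_hom j a b k :
  conv (fun i => if i == j then a else 0) b k =
  if (j <= k)%N then a * b (k - j)%N else 0.
Proof.
rewrite /conv; case: leqP => [jk|kj].
  rewrite (bigD1 (inord j)) //= inordK // eqxx big1 ?addr0 // => i.
  by rewrite -val_eqE /= inordK // => /negPf ->; rewrite mul0r.
rewrite big1 // => i _; rewrite ltn_eqF ?mul0r //.
exact: leq_ltn_trans (leq_ord i) kj.
Qed.

Fact gr_mulA : associative gr_mul.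
Proof.
move=> x y z; have [lx ly lz] := And3 (gr_lifts_rep x) (gr_lifts_rep y) (gr_lifts_rep z).
apply: (@gr_lifts_uniq _ _ (gr_mul x (gr_mul y z)) (gr_mul (gr_mul x y) z)).
- by apply: gr_lifts_mul; [exact: lx | apply: gr_lifts_mul; [exact: ly | exact: lz]].
- by apply: gr_lifts_mul; [apply: gr_lifts_mul; [exact: lx | exact: ly] | exact: lz].
- by move=> k; exact: convA.
Qed.

Fact gr_mulC : commutative gr_mul.
Proof.
by move=> x y; apply: dsumP => k /=; rewrite /gr_mul_val convC.
Qed.

Fact gr_mul1 : left_id gr_one gr_mul.
Proof.
move=> x; apply: (@gr_lifts_uniq _ _ (gr_mul gr_one x) x).
- exact: gr_lifts_mul (gr_lifts_hom fil1) (gr_lifts_rep x).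
- exact: gr_lifts_rep.
- by move=> k; rewrite conv_hom subn0 mul1r.
Qed.

Fact gr_mulDl : left_distributive gr_mul +%R.
Proof.
move=> x y z; have [lx ly lz] := And3 (gr_lifts_rep x) (gr_lifts_rep y) (gr_lifts_rep z).
apply: (@gr_lifts_uniq _ _ (gr_mul (x + y) z) (gr_mul x z + gr_mul y z)).
- exact: gr_lifts_mul (gr_lifts_add lx ly) lz.
- apply: (@gr_lifts_add _ _ (gr_mul x z) (gr_mul y z)).
    exact: gr_lifts_mul lx lz.
  exact: gr_lifts_mul ly lz.
- by move=> k; rewrite /conv -big_split; apply: eq_bigr => i _; rewrite mulrDl.
Qed.

HB.instance Definition _ := GRing.Zmodule_isComPzRing.Build gr
  gr_mulA gr_mulC gr_mul1 gr_mulDl.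

Lemma gr_homM j k a b : a \in fil F j -> b \in fil F k ->
  gr_hom j a * gr_hom k b = gr_hom (j + k) (a * b).
Proof.
move=> aj bk.
apply: (@gr_lifts_uniq _ _ (gr_mul (gr_hom j a) (gr_hom k b))).
- exact: gr_lifts_mul (gr_lifts_hom aj) (gr_lifts_hom bk).
- exact: gr_lifts_hom (filM aj bk).
- move=> i; rewrite conv_hom; case: leqP => [ji|ij].
    by rewrite -(eqn_add2l j) subnKC //; case: eqP; rewrite ?mulr0.
  by case: eqP ij => // ->; rewrite ltnNge leq_addr.
Qed.

Lemma gr_homB k a b : a \in fil F k -> b \in fil F k ->
  gr_hom k (a - b) = gr_hom k a - gr_hom k b.
Proof.
move=> ak bk; apply: dsumP => j.
rewrite -[RHS]/(gr_hom_val k a j - gr_hom_val k b j) /= /gr_hom_val.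
by case: eqP => [->|_]; rewrite ?subr0 // gr_clsB.
Qed.

Fact gr_scalar_zmod : zmod_morphism (fun c : K => gr_hom 0 (alg_scalar c)).
Proof. by move=> c d; rewrite raddfB gr_homB ?fil_scalar. Qed.
Fact gr_scalar_monoid : monoid_morphism (fun c : K => gr_hom 0 (alg_scalar c)).
Proof. by split=> [|c d]; rewrite ?rmorph1 // rmorphM gr_homM ?fil_scalar. Qed.
HB.instance Definition _ := isPzComAlg.Build K gr gr_scalar_zmod gr_scalar_monoid.

Lemma gr_homP k (x : gr) :
  in_summand k (x : dsum gr_piece) <-> exists2 a, a \in fil F k & x = gr_hom k a.
Proof.
split=> [xk|[a _ ->] j /negPf jk]; last by rewrite /= /gr_hom_val jk.
exists (gr_rep (x k)); first exact: gr_repP.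
apply: dsumP => j; rewrite /= /gr_hom_val; case: eqP => [->|/eqP /xk //].
by rewrite gr_repK.
Qed.

Lemma gr_hom_eq0 k a : a \in fil F k -> gr_hom k a = 0 <-> a \in fil_pred k.
Proof.
move=> ak; rewrite -[a in a \in fil_pred k]subr0 -gr_cls_eq ?rpred0 // gr_cls0.
split=> [/(congr1 (fun x : gr => x k))|h0].
  by rewrite /gr_val /= /gr_hom_val eqxx.
apply: dsumP => j; rewrite /= /gr_hom_val; case: eqP => // ->.
exact: h0.
Qed.

End AssociatedGraded.

(* Signs: [Some true] is +, [Some false] is -, [None] is 0. *)
Notation sign := (option bool).
Notation signed_subset I := {ffun I -> sign}.

Section ConditionalOrientedMatroid.
Variable I : finType.
Implicit Types (X Y Z : signed_subset I) (M : {set signed_subset I}).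

Definition sopp X : signed_subset I := [ffun i => omap negb (X i)].
Definition sep X Y : {set I} := [set i | (X i == sopp Y i) && (X i != None)].
Definition scomp X Y : signed_subset I := [ffun i => if X i != None then X i else Y i].

Definition face_symmetry M : Prop :=
  forall X Y, X \in M -> Y \in M -> scomp X (sopp Y) \in M.

Definition strong_elimination M : Prop :=
  forall X Y i, X \in M -> Y \in M -> i \in sep X Y ->
  exists Z, [/\ Z \in M, Z i = None & forall j, j \notin sep X Y -> Z j = scomp X Y j].

Definition cond_oriented_matroid M : Prop := face_symmetry M /\ strong_elimination M.

End ConditionalOrientedMatroid.

Section BigVG.
Variables (F : fieldType) (I : finType) (M : {set signed_subset I}).

Local Notation covector := {X : signed_subset I | X \in M}.

Definition bigVG : Type := fun_alg F covector.
HB.instance Definition _ := PzComAlg.on bigVG.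

(* [heaviside i true] is h_i^+, [heaviside i false] is h_i^-. *)
Definition heaviside (i : I) (s : bool) : bigVG :=
  alg_of_fun (fun X : covector => (val X i == Some s)%:R).

(* The value in [bigVG] of a polynomial in the Heaviside functions. *)
Definition heaviside_poly (p : {mpoly F[#|{: I * bool}|]}) : bigVG :=
  alg_of_fun (fun X : covector => p.@[fun j => heaviside (enum_val j).1 (enum_val j).2 X]).

(* [msize p <= k.+1] says that [p] has degree at most [k]. *)
Definition bigVG_fil (k : nat) : {pred bigVG} := fun f =>
  `[< exists2 p : {mpoly F[#|{: I * bool}|]}, (msize p <= k.+1)%N & f = heaviside_poly p >].

Fact bigVG_fil_zmod k : zmod_closed (bigVG_fil k).
Proof.
split.
  apply/asboolP; exists 0; first by rewrite mmeasure0.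
  by apply/ffunP => X; rewrite !ffunE meval0.
move=> _ _ /asboolP[p pk ->] /asboolP[q qk ->]; apply/asboolP.
exists (p - q); last by apply/ffunP => X; rewrite !ffunE mevalB.
apply: leq_trans (mmeasureD_le _ _ _) _; rewrite geq_max pk.
by rewrite mmeasureN.
Qed.

Fact bigVG_filS k : {subset bigVG_fil k <= bigVG_fil k.+1}.
Proof.
by move=> _ /asboolP[p pk ->]; apply/asboolP; exists p; first exact: leqW.
Qed.

Fact bigVG_fil_scalar (c : F) : alg_scalar c \in bigVG_fil 0.
Proof.
apply/asboolP; exists c%:MP; first by rewrite mmeasureC; case: eqP.
by apply/ffunP => X; rewrite !ffunE mevalC.
Qed.

Fact bigVG_filM j k a b :
  a \in bigVG_fil j -> b \in bigVG_fil k -> a * b \in bigVG_fil (j + k).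
Proof.
move=> /asboolP[p pj ->] /asboolP[q qk ->]; apply/asboolP; exists (p * q); last first.
  by apply/ffunP => X; rewrite !ffunE mevalM.
have [->|p0] := eqVneq p 0; first by rewrite mul0r mmeasure0.
have [->|q0] := eqVneq q 0; first by rewrite mulr0 mmeasure0.
rewrite msizeM // -ltnS prednK ?addn_gt0 ?lt0n ?mmeasure_poly_eq0 ?p0 //.
by apply: leq_trans (leq_add pj qk) _; rewrite addnS addSn.
Qed.

Definition bigVG_filtration : filtration bigVG :=
  Filtration bigVG_fil_zmod bigVG_filS bigVG_fil_scalar bigVG_filM.

Definition gr_bigVG : Type := gr bigVG_filtration.
HB.instance Definition _ := PzComAlg.on gr_bigVG.

End BigVG.
Arguments heaviside F {I} M i s.

Section OrbitHarmonics.
Variables (F : fieldType) (V : finType).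

(* The coordinate ring of F^V; its variables are numbered through [enum_rank]. *)
Local Notation coord_ring := {mpoly F[#|V|]}.
Definition coordinate (v : V) : coord_ring := 'X_(enum_rank v).
Definition coord_eval (f : coord_ring) (z : {ffun V -> F}) : F :=
  f.@[fun j => z (enum_val j)].

Definition top_component (f : coord_ring) : coord_ring :=
  pihomog mdeg (msize f).-1 f.

Variable Z : {fset {ffun V -> F}}.

Definition locus_fun : Type := fun_alg F Z.
HB.instance Definition _ := PzComAlg.on locus_fun.

Definition vanishing : {pred coord_ring} := fun f =>
  [forall z : Z, coord_eval f (val z) == 0].

Fact vanishing_zmod : zmod_closed vanishing.
Proof.
split=> [|f g]; first by apply/forallP => z; rewrite /coord_eval meval0.
move=> /forallP fZ /forallP gZ; apply/forallP => z.
by move: (fZ z) (gZ z); rewrite /coord_eval mevalB => /eqP-> /eqP->; rewrite subr0.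
Qed.
HB.instance Definition _ :=
  GRing.isZmodClosed.Build coord_ring vanishing vanishing_zmod.

Fact vanishing_mull (a f : coord_ring) : vanishing f -> vanishing (a * f).
Proof.
move=> /forallP fZ; apply/forallP => z.
by move: (fZ z); rewrite /coord_eval mevalM => /eqP->; rewrite mulr0.
Qed.
HB.instance Definition _ := isIdeal.Build coord_ring vanishing vanishing_mull.

Definition gr_vanishing : idealType coord_ring :=
  gen_ideal (fun t => exists f, [/\ f \in vanishing, f != 0 & t = top_component f]).

(* F[y] / I(Z) *)
Definition coord_quot : Type := quotalg vanishing.
HB.instance Definition _ := PzComAlg.on coord_quot.
Definition coord_class (f : coord_ring) : coord_quot := quotalg_class vanishing f.

(* R(Z) = F[y] / gr I(Z) *)
Definition orbit_ring : Type := quotalg gr_vanishing.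
HB.instance Definition _ := PzComAlg.on orbit_ring.
Definition orbit_class (f : coord_ring) : orbit_ring := quotalg_class gr_vanishing f.

Definition orbit_degree (k : nat) (u : orbit_ring) : Prop :=
  exists2 f : coord_ring, f \is k.-homog & u = orbit_class f.

End OrbitHarmonics.

Section BigLocus.
Variables (F : fieldType) (I : finType).

Definition covector_point (X : signed_subset I) : {ffun I * sign -> F} :=
  [ffun v => (X v.1 == v.2)%:R].

Definition big_locus (M : {set signed_subset I}) : {fset {ffun I * sign -> F}} :=
  [fset covector_point X | X in M]%fset.

End BigLocus.

(* Main.v *)
Require Import Defs.
From HB Require Import structures.
From mathcomp Require Import all_boot all_order all_algebra.
From mathcomp Require Import finmap boolp.
From mathcomp.multinomials Require Import mpoly.

Set Implicit Arguments.
Unset Strict Implicit.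
Unset Printing Implicit Defensive.

Import GRing.Theory.
Local Open Scope ring_scope.

(** Evaluation at the points of a family [pt : T -> F^V] is a morphism from the
    polynomial ring to the functions on [T].  When [pt] is injective it is onto, by
    Lagrange interpolation ([eval_at_surj]), and its kernel is the vanishing ideal
    of the range ([eval_at_ker]).  The points of the big locus are parametrized in
    two ways: by themselves, which gives F[Z] = S / I(Z), and by the covectors,
    which gives S / I(Z) = VG.  In the second case y_i^+, y_i^-, z_i evaluate to
    h_i^+, h_i^-, 1 - h_i^+ - h_i^-.  Passing from the y, z to the h is thus a
    substitution by polynomials of degree at most 1, and so is the way back; hence
    F_k is exactly the image of the polynomials of degree at most k
    ([bigVG_filE]).

    The graded statement follows formally from this fact.  Let [e : S -> A] be a
    morphism of algebras with kernel J, where F_k is the image of the degree <= k part.  Send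
    f to the family of classes of e(f_k) in F_k / F_(k-1), with f_k the homogeneous
    components of f.  This map [symbol_map] is multiplicative because the components
    of a product are convolutions, and onto because e(g) and e(g_k) have the same
    class for g of degree at most k.  The class of e(f_k) vanishes exactly when
    e(f_k) = e(g) with deg g < k, that is, when f_k is zero or the top component of
    the element f_k - g of J.  So the kernel is generated by the top components of
    J, and the quotient by it is the associated graded ring
    ([gr_quotient_iso]). *)

(** * Degrees and homogeneous components *)

Section DegreeLemmas.
Variables (n : nat) (K : comNzRingType).
Implicit Types p q : {mpoly K[n]}.

Lemma pihomogXM k m q :
  pihomog mdeg k ('X_[m] * q) =
  if (mdeg m <= k)%N then 'X_[m] * pihomog mdeg (k - mdeg m) q else 0.
Proof.
elim/mpolyind: q => [|c m' q _ _ IH].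
  by rewrite mulr0 !pihomog0 mulr0 if_same.
rewrite mulrDr pihomogD IH -scalerAr linearZ /= -mpolyXD pihomogX /= mdegD.
case: leqP => [lemk|ltkm]; last first.
  by rewrite gtn_eqF ?scaler0 ?addr0 // ltn_addr.
rewrite pihomogD mulrDr linearZ /= pihomogX -scalerAr.
congr (_ *: _ + _); rewrite -[in RHS](eqn_add2l (mdeg m)) subnKC //.
by case: eqP; rewrite ?mulr0 ?mpolyXD.
Qed.

(** Bilinearity reduces this to two monomials, where a single summand survives. *)
Lemma pihomogM k p q :
  pihomog mdeg k (p * q) =
  \sum_(i < k.+1) pihomog mdeg i p * pihomog mdeg (k - i) q.
Proof.
elim/mpolyind: p => [|c m p _ _ IH].
  by rewrite mul0r pihomog0 big1 // => i _; rewrite pihomog0 mul0r.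
rewrite mulrDl pihomogD IH -scalerAl linearZ /= pihomogXM.
under [RHS]eq_bigr do rewrite pihomogD mulrDl linearZ /= pihomogX -scalerAl.
rewrite big_split /= -scaler_sumr; congr (_ *: _ + _).
case: leqP => [lemk|ltkm].
  rewrite (bigD1 (Ordinal (lemk : mdeg m < k.+1)%N)) //= eqxx big1 ?addr0 // => i.
  by rewrite -val_eqE /= eq_sym => /negPf ->; rewrite mul0r.
rewrite big1 // => i _; rewrite gtn_eqF ?mul0r //.
exact: leq_ltn_trans (leq_ord i) ltkm.
Qed.

Lemma msize_leP d p :
  reflect (forall m, m \in msupp p -> (mdeg m < d)%N) (msize p <= d)%N.
Proof.
apply: (iffP idP) => [pd m /msize_mdeg_lt mp|pd]; first exact: leq_trans pd.
by rewrite msizeE big_seq; apply: (big_ind (fun x => x <= d)%N) => // x y;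
  rewrite geq_max => ->.
Qed.

Lemma msize_homog k p : p \is k.-homog -> (msize p <= k.+1)%N.
Proof. by move=> /dhomogP hp; apply/msize_leP => m /hp ->. Qed.

Lemma msizeB_pihomog k p :
  (msize p <= k.+1)%N -> (msize (p - pihomog mdeg k p) <= k)%N.
Proof.
move=> pk; have -> : p - pihomog mdeg k p = \sum_(i < k) pihomog mdeg i p.
  by rewrite {1}(pihomog_partitionE pk) big_ord_recr addrK.
apply/(leq_trans (mmeasure_sum _ _ _ _))/bigmax_leqP => i _.
exact: leq_trans (msize_homog (pihomogP _ _ _)) (ltn_ord i).
Qed.

(** This recognizes a homogeneous polynomial as the top component of an element of
    an ideal, once it is known modulo that ideal up to lower degree. *)
Lemma pihomog_top_sub k p q :
  p \is k.-homog -> (msize q <= k)%N -> p != 0 ->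
  p - q != 0 /\ pihomog mdeg (msize (p - q)).-1 (p - q) = p.
Proof.
move=> hp qk p0.
have q0 : pihomog mdeg k q = 0.
  rewrite pihomogE big_seq_cond big1 // => m /andP[mq /eqP mk].
  by move/msize_leP: qk => /(_ m mq); rewrite mk ltnn.
have topE : pihomog mdeg k (p - q) = p by rewrite pihomogB q0 subr0 pihomog_dE.
have pq0 : p - q != 0 by apply: contra_neq p0 => pq; rewrite -topE pq pihomog0.
split=> //; suff -> : msize (p - q) = k.+1 by [].
apply/eqP; rewrite eqn_leq; apply/andP; split.
  apply: leq_trans (mmeasureD_le _ _ _) _; rewrite mmeasureN geq_max msize_homog //.
  exact: leqW.
rewrite ltnNge; apply: contra p0 => pqk; apply/eqP; rewrite -topE.
rewrite pihomogE big_seq_cond big1 // => m /andP[mq /eqP mk].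
by move/msize_leP: pqk => /(_ m mq); rewrite mk ltnn.
Qed.

End DegreeLemmas.

Section Subst.
Variables (n l : nat) (K : idomainType).

Lemma msize_leM j k (p q : {mpoly K[n]}) :
  (msize p <= j.+1)%N -> (msize q <= k.+1)%N -> (msize (p * q) <= (j + k).+1)%N.
Proof.
have [->|p0] := eqVneq p 0; first by rewrite mul0r mmeasure0.
have [->|q0] := eqVneq q 0; first by rewrite mulr0 mmeasure0.
move=> pj qk; rewrite msizeM // -ltnS prednK ?addn_gt0 ?lt0n ?mmeasure_poly_eq0 ?p0 //.
by apply: leq_trans (leq_add pj qk) _; rewrite addnS addSn.
Qed.

Lemma msize_comp_affine (lq : l.-tuple {mpoly K[n]}) (p : {mpoly K[l]}) k :
  (forall i, (msize (tnth lq i) <= 2)%N) -> (msize p <= k.+1)%N ->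
  (msize (p \mPo lq) <= k.+1)%N.
Proof.
move=> lq2 /msize_leP pk; rewrite comp_mpolyEX big_seq.
apply/(leq_trans (mmeasure_sum _ _ _ _))/bigmax_leqP_seq => m mp _.
apply/(leq_trans (msizeZ_le _ _))/(leq_trans _ (pk m mp)).
rewrite comp_mpolyX mdegE.
apply: (big_ind2 (fun (r : {mpoly K[n]}) d => msize r <= d.+1)%N).
- by rewrite msize1.
- by move=> r d r' d'; exact: msize_leM.
move=> i _; elim: (m i) => [|e IH]; first by rewrite expr0 msize1.
by rewrite exprS; apply: (@msize_leM 1 e).
Qed.

End Subst.

(** * Quotient algebras *)

(** The first isomorphism theorem for algebras that may be zero. *)
Lemma quotalg_iso (K : pzRingType) (A B : pzComAlgType K) (J : idealType A)
    (e : {rmorphism A -> B}) :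
  (forall c : K, e (alg_scalar c) = alg_scalar c) ->
  (forall a, (a \in (J : {pred A})) <-> e a = 0) -> (forall b, exists a, e a = b) ->
  exists2 h : quotalg J -> B, alg_iso h & forall a, h (quotalg_class J a) = e a.
Proof.
move=> eK kerE surj.
pose h (u : quotalg J) : B := e (repr (u : Quotient.quot J)).
have hE a : h (quotalg_class J a) = e a.
  by apply/eqP; rewrite -subr_eq0 -raddfB; apply/eqP/kerE/quot_class_repr.
exists h => //; split.
- elim/quotalg_ind => x; elim/quotalg_ind => y.
  by rewrite -raddfB !hE raddfB.
- split; first by rewrite -[1](rmorph1 (@quotalg_class A J)) hE rmorph1.
  elim/quotalg_ind => x; elim/quotalg_ind => y.
  by rewrite -rmorphM !hE rmorphM.
- by move=> c; rewrite hE.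
- have [r rK] := choice surj.
  exists (fun b => quotalg_class J (r b)) => [|b]; last by rewrite hE.
  elim/quotalg_ind => x; apply/quot_class_eq/kerE.
  by rewrite rmorphB /= rK hE subrr.
Qed.

(** * The associated graded ring as a quotient of the polynomial ring *)

Section GradedQuotient.
Variables (K : comNzRingType) (n : nat) (A : pzComAlgType K) (Fil : filtration A).
Local Notation S := {mpoly K[n]}.
Variable (e : {rmorphism S -> A}).
Hypothesis eK : forall c : K, e c%:MP = alg_scalar c.
Hypothesis filE : forall k a,
  a \in fil Fil k <-> exists2 f : S, (msize f <= k.+1)%N & a = e f.

Lemma fil_homog k f : f \is k.-homog -> e f \in fil Fil k.
Proof. by move=> hf; apply/filE; exists f => //; exact: msize_homog. Qed.

Lemma fil_pihomog k f : e (pihomog mdeg k f) \in fil Fil k.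
Proof. exact: fil_homog (pihomogP _ _ _). Qed.

(** Since [msize] is the degree plus one, and zero only at 0, the same formula
    covers the convention F_(-1) = 0. *)
Lemma fil_predE k a :
  a \in fil_pred Fil k <-> exists2 f : S, (msize f <= k)%N & a = e f.
Proof.
case: k => [|k]; last exact: filE.
rewrite inE; split=> [/eqP ->|[f]]; first by exists 0; rewrite ?mmeasure0 ?raddf0.
by rewrite leqn0 mmeasure_poly_eq0 => /eqP -> ->; rewrite raddf0.
Qed.

Fact symbol_fin (f : S) :
  exists N, forall k, (N <= k)%N -> gr_cls Fil k (e (pihomog mdeg k f)) = 0.
Proof.
exists (msize f) => k fk; rewrite pihomogE big_seq_cond big1 ?raddf0 ?gr_cls0 //.
by move=> m /andP[/msize_mdeg_lt mf /eqP mk]; move: (leq_trans mf fk); rewrite mk ltnn.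
Qed.
(** The graded morphism that [e] induces, still defined on polynomials: on a
    homogeneous f of degree k it is the class of [e f] in F_k / F_(k-1). *)
Definition symbol_map (f : S) : gr Fil := DSum (symbol_fin f).

Lemma symbol_lifts f : gr_lifts (fun k => e (pihomog mdeg k f)) (symbol_map f).
Proof. by move=> k; split; first exact: fil_pihomog. Qed.

Lemma symbol_homog k f : f \is k.-homog -> symbol_map f = gr_hom Fil k (e f).
Proof.
move=> hf; apply: (gr_lifts_uniq (symbol_lifts f) (gr_lifts_hom (fil_homog hf))) => j.
case: eqP => [->|/eqP jk]; first by rewrite pihomog_dE.
by rewrite (pihomog_ne0 _ hf) ?raddf0 // eq_sym.
Qed.

Fact symbol_zmod : zmod_morphism symbol_map.
Proof.
move=> f g; apply: dsumP => k.
rewrite -[RHS]/(gr_cls Fil k _ - gr_cls Fil k _) -gr_clsB ?fil_pihomog //=.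
by rewrite pihomogB rmorphB.
Qed.

Fact symbol_monoid : monoid_morphism symbol_map.
Proof.
split; first by rewrite (symbol_homog (dhomog1 _ _)) rmorph1.
move=> f g; apply: (@gr_lifts_uniq _ _ _ _ _ (symbol_map (f * g))
  (gr_mul (symbol_map f) (symbol_map g))) => [||k].
- exact: symbol_lifts.
- exact: gr_lifts_mul (symbol_lifts f) (symbol_lifts g).
by rewrite /conv /= pihomogM rmorph_sum; apply: eq_bigr => i _; rewrite rmorphM.
Qed.
HB.instance Definition _ := GRing.isZmodMorphism.Build S (gr Fil) symbol_map symbol_zmod.
HB.instance Definition _ := GRing.isMonoidMorphism.Build S (gr Fil) symbol_map symbol_monoid.

Lemma symbol_scalar (c : K) : symbol_map c%:MP = alg_scalar c.
Proof.
rewrite (@symbol_homog 0) ?eK //.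
by apply/dhomogP => m; rewrite msuppC; case: eqP => // _; rewrite inE => /eqP ->; exact: mf0.
Qed.

Lemma gr_hom_symbol k f : (msize f <= k.+1)%N ->
  gr_hom Fil k (e f) = symbol_map (pihomog mdeg k f).
Proof.
move=> fk; rewrite (symbol_homog (pihomogP _ _ _)).
have fF : e f \in fil Fil k by apply/filE; exists f.
apply/eqP; rewrite -subr_eq0 -gr_homB ?fil_pihomog //; apply/eqP/gr_hom_eq0.
  by rewrite -rmorphB rmorphB; apply: rpredB => //; exact: fil_pihomog.
apply/fil_predE; exists (f - pihomog mdeg k f); first exact: msizeB_pihomog.
by rewrite rmorphB.
Qed.

(** A class in F_k / F_(k-1) lifts to [e (r k)] with [r k] of degree at most k, and
    the component of degree k of [r k] already represents it. *)
Lemma symbol_surj (x : gr Fil) : exists f, symbol_map f = x.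
Proof.
have /choice[r rP] k : exists f : S, (msize f <= k.+1)%N /\ gr_rep (x k) = e f.
  by have /filE[f fk fE] := gr_repP (x k); exists f.
case: (dsum_fin x) => N xN; exists (\sum_(j < N) pihomog mdeg j (r j)).
apply: dsumP => k /=.
have -> : pihomog mdeg k (\sum_(j < N) pihomog mdeg j (r j)) =
    if (k < N)%N then pihomog mdeg k (r k) else 0.
  rewrite raddf_sum /=; case: ltnP => kN.
    rewrite (bigD1 (Ordinal kN)) //= pihomog_id big1 ?addr0 // => j jk.
    by apply: (pihomog_ne0 _ (pihomogP _ _ _)).
  rewrite big1 // => j _; apply: (pihomog_ne0 _ (pihomogP _ _ _)).
  by rewrite neq_ltn (leq_trans (ltn_ord j) kN).
case: ltnP => [_|/xN ->]; last by rewrite raddf0 gr_cls0.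
have [rk rE] := rP k; rewrite -[RHS](gr_repK (x k)) rE.
have := congr1 (fun y : gr Fil => y k) (gr_hom_symbol rk).
rewrite /gr_val /= /gr_hom_val eqxx => ->.
by rewrite pihomog_id.
Qed.

Variable J : idealType S.
Hypothesis kerE : forall f, f \in (J : {pred S}) <-> e f = 0.
Local Notation gr_ideal :=
  (gen_ideal (fun t => exists f, [/\ f \in (J : {pred S}), f != 0 &
     t = pihomog mdeg (msize f).-1 f])).

(** If f_k is sent to 0, then [e f_k = e g] for some g of degree less than k; thus
    f_k - g lies in J and has top component f_k unless f_k = 0.  Conversely, the
    top component of g in J has the same symbol in its degree as g, and
    [e g = 0]. *)
Lemma symbol_ker f : f \in gr_ideal <-> symbol_map f = 0.
Proof.
split=> [/asboolP[s sT ->]|f0].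
  rewrite rmorph_sum big_seq big1 // => -[a t] /sT[g [gJ g0 tE]] /=.
  rewrite rmorphM /= (tE : t = _) -gr_hom_symbol; last by rewrite -mpolySpred.
  suff -> : gr_hom Fil (msize g).-1 (e g) = 0 by rewrite mulr0.
  have /kerE -> := gJ.
  by apply/gr_hom_eq0; rewrite ?rpred0.
rewrite [f](pihomog_partitionE (leqnn (msize f))); apply: rpred_sum => k _.
have : e (pihomog mdeg k f) \in fil_pred Fil k.
  apply/gr_hom_eq0; first exact: fil_pihomog.
  have := congr1 (fun y : gr Fil => y k) f0.
  rewrite /gr_val /= => fk0; apply: dsumP => j /=.
  by rewrite /gr_hom_val; case: eqP => [->|].
move=> /fil_predE[g gk fg].
have [->|p0] := eqVneq (pihomog mdeg k f) 0; first exact: rpred0.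
have [d0 topE] := pihomog_top_sub (pihomogP _ _ _) gk p0.
apply/asboolP; exists [:: (1, pihomog mdeg k f)]; last by rewrite big_seq1 mul1r.
move=> _ /[!inE] /eqP -> /=; exists (pihomog mdeg k f - g); split=> //.
by apply/kerE; rewrite rmorphB /= fg subrr.
Qed.

Lemma gr_quotient_iso :
  exists psi : quotalg gr_ideal -> gr Fil,
  [/\ alg_iso psi,
      forall k u, (exists2 f, f \is k.-homog & u = quotalg_class gr_ideal f) <->
        in_summand k (psi u : dsum _)
    & forall k f, f \is k.-homog -> psi (quotalg_class gr_ideal f) = gr_hom Fil k (e f)].
Proof.
have [psi psi_iso psiE] := quotalg_iso symbol_scalar symbol_ker symbol_surj.
have psi_homog k f : f \is k.-homog ->
    psi (quotalg_class gr_ideal f) = gr_hom Fil k (e f).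
  by move=> hf; rewrite psiE; exact: symbol_homog.
exists psi; split=> // k u; split=> [[f hf ->]|/gr_homP[_ /filE[f fk ->] uE]].
  by rewrite (psi_homog k) //; apply/gr_homP; exists (e f) => //; exact: fil_homog.
exists (pihomog mdeg k f); first exact: pihomogP.
have [_ _ _ /bij_inj] := psi_iso; apply.
by rewrite uE gr_hom_symbol // -psiE.
Qed.

End GradedQuotient.

(** * Evaluation at finitely many points *)

Section FamilyEvaluation.
Variables (F : fieldType) (V T : finType) (pt : T -> {ffun V -> F}).
Local Notation S := {mpoly F[#|V|]}.

Definition eval_at (f : S) : fun_alg F T := alg_of_fun (fun t => coord_eval f (pt t)).

Lemma eval_atE f t : eval_at f t = coord_eval f (pt t).
Proof. exact: ffunE. Qed.

Fact eval_at_zmod : zmod_morphism eval_at.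
Proof. by move=> f g; apply/ffunP => t; rewrite !ffunE /coord_eval mevalB. Qed.
Fact eval_at_monoid : monoid_morphism eval_at.
Proof.
by split=> [|f g]; apply/ffunP => t; rewrite !ffunE /coord_eval ?meval1 ?mevalM.
Qed.
HB.instance Definition _ := GRing.isZmodMorphism.Build S (fun_alg F T) eval_at eval_at_zmod.
HB.instance Definition _ := GRing.isMonoidMorphism.Build S (fun_alg F T) eval_at eval_at_monoid.

Lemma eval_at_scalar (c : F) : eval_at c%:MP = alg_scalar c.
Proof. by apply/ffunP => t; rewrite !ffunE /coord_eval mevalC. Qed.

Lemma coord_eval_coordinate v (z : {ffun V -> F}) : coord_eval (coordinate F v) z = z v.
Proof. by rewrite /coord_eval mevalXU enum_rankK. Qed.

(** An affine function of a coordinate in which the two points differ. *)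
Lemma separating_poly t u : pt t != pt u ->
  exists f : S, coord_eval f (pt t) = 1 /\ coord_eval f (pt u) = 0.
Proof.
move=> tu; have [v tuv] : exists v, pt t v != pt u v.
  apply/existsP; apply: contra_neqT tu => /existsPn tu; apply/ffunP => v.
  by apply/eqP; have := tu v; rewrite negbK.
exists ((pt t v - pt u v)^-1 *: (coordinate F v - (pt u v)%:MP)).
have ev z : coord_eval ((pt t v - pt u v)^-1 *: (coordinate F v - (pt u v)%:MP)) z =
    (pt t v - pt u v)^-1 * (z v - pt u v).
  by rewrite -(coord_eval_coordinate v z) /coord_eval mevalZ mevalB mevalC.
by rewrite !ev subrr mulr0 mulVf // subr_eq0.
Qed.

Hypothesis pt_inj : injective pt.

(** Lagrange interpolation: products of polynomials that separate one point of the
    family from another give the indicator functions. *)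
Lemma eval_at_surj (a : fun_alg F T) : exists f, eval_at f = a.
Proof.
have /choice[r rP] (tu : T * T) : exists f : S, tu.1 != tu.2 ->
    coord_eval f (pt tu.1) = 1 /\ coord_eval f (pt tu.2) = 0.
  case: (eqVneq tu.1 tu.2) => [_|ne]; first by exists 0.
  by have [|f fP] := @separating_poly tu.1 tu.2; [rewrite (inj_eq pt_inj)|exists f].
exists (\sum_t a t *: \prod_(u | t != u) r (t, u)).
apply/ffunP => w; rewrite ffunE /coord_eval raddf_sum /=.
rewrite (bigD1 w) //= mevalZ rmorph_prod /= [X in a w * X]big1 ?mulr1; last first.
  by move=> u wu; have [] := rP (w, u) wu.
rewrite big1 ?addr0 // => t tw; rewrite mevalZ rmorph_prod (bigD1 w) //=.
by have [_] := rP (t, w) tw; rewrite /coord_eval => ->; rewrite mul0r mulr0.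
Qed.

Lemma eval_at_ker (Z : {fset {ffun V -> F}}) : (forall z, z \in Z <-> exists t, z = pt t) ->
  forall f, f \in (vanishing Z : {pred S}) <-> eval_at f = 0.
Proof.
move=> ZE f; split=> [/forallP fZ|f0].
  apply/ffunP => t; rewrite !ffunE; have tZ : pt t \in Z by apply/ZE; exists t.
  exact/eqP/(fZ [` tZ]%fset).
apply/forallP => z; have /ZE[t ->] := valP z.
by rewrite -eval_atE f0 /fun_of_alg ffunE.
Qed.

End FamilyEvaluation.

(** * The big locus and the big Varchenko-Gelfand ring *)

Section BigLocus.
Variables (F : fieldType) (I : finType) (M : {set signed_subset I}).
Local Notation covector := {X : signed_subset I | X \in M}.
Local Notation S := {mpoly F[#|{: I * sign}|]}.

Definition covector_family (X : covector) := covector_point F (val X).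

Lemma covector_family_inj : injective covector_family.
Proof.
move=> X Y XY; apply/val_inj/ffunP => i.
have := congr1 (fun z : {ffun I * sign -> F} => z (i, val X i)) XY.
rewrite !ffunE /= eqxx; case: eqP => // _ /eqP.
by rewrite oner_eq0.
Qed.

Lemma big_locusP z : z \in big_locus F M <-> exists X, z = covector_family X.
Proof.
split=> [/imfsetP[X /= XM ->]|[X ->]]; first by exists (exist _ X XM).
by apply/imfsetP; exists (val X) => //=; exact: valP.
Qed.

Lemma eval_at_heaviside i s :
  eval_at covector_family (coordinate F (i, Some s)) = heaviside F M i s.
Proof. by apply/ffunP => X; rewrite !ffunE coord_eval_coordinate ffunE. Qed.

Lemma eval_at_zero_coordinate i :
  eval_at covector_family (coordinate F (i, None)) =
  1 - heaviside F M i true - heaviside F M i false.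
Proof.
apply/ffunP => X; rewrite !ffunE coord_eval_coordinate ffunE /=.
by case: (val X i) => [[]|]; rewrite !eqxx /= ?subr0 ?subrr.
Qed.

(** Both inclusions come from a substitution of degree at most 1: the h are
    coordinates, and each coordinate is an affine expression in the h. *)
Lemma bigVG_filE k (a : bigVG F M) :
  a \in bigVG_fil k <->
  exists2 f : S, (msize f <= k.+1)%N & a = eval_at covector_family f.
Proof.
split=> [/asboolP[p pk ->]|[f fk ->]].
  pose lq := [tuple coordinate F ((enum_val j).1, Some (enum_val j).2)
               | j < #|{: I * bool}|].
  exists (p \mPo lq).
    by apply: msize_comp_affine => // j; rewrite tnth_mktuple msizeX mdeg1.
  apply/ffunP => X; rewrite !ffunE /coord_eval comp_mpoly_meval.
  apply: meval_eq => j; rewrite tnth_mktuple -eval_at_heaviside.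
  by rewrite /fun_of_alg ffunE.
pose h i s : {mpoly F[#|{: I * bool}|]} := 'X_(enum_rank (i, s)).
pose sub (v : I * sign) := if v.2 is Some s then h v.1 s else 1 - h v.1 true - h v.1 false.
pose lq := [tuple sub (enum_val j) | j < #|{: I * sign}|].
apply/asboolP; exists (f \mPo lq).
  apply: msize_comp_affine => // j; rewrite tnth_mktuple /sub.
  case: (enum_val j) => i [s|] /=; rewrite ?msizeX ?mdeg1 //.
  do 2![apply: (leq_trans (mmeasureD_le _ _ _)); rewrite mmeasureN geq_max msizeX mdeg1 andbT].
  by rewrite msize1.
apply/ffunP => X; rewrite !ffunE comp_mpoly_meval /coord_eval.
apply: meval_eq => j; rewrite tnth_mktuple ffunE /sub.
have hE i s : (h i s).@[fun j => heaviside F M (enum_val j).1 (enum_val j).2 X] =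
    (val X i == Some s)%:R by rewrite mevalXU enum_rankK /= /fun_of_alg ffunE.
case: (enum_val j) => i [s|] /=; first by rewrite hE.
by rewrite !mevalB meval1 !hE; case: (val X i) => [[]|]; rewrite !eqxx /= ?subr0 ?subrr.
Qed.

End BigLocus.

Theorem proposition4p2 (F : fieldType) (I : finType) (M : {set signed_subset I})
    (hM : cond_oriented_matroid M) :
  let Z := big_locus F M in
  exists (ev : coord_quot Z -> locus_fun Z)
         (phi : coord_quot Z -> bigVG F M)
         (psi : orbit_ring Z -> gr_bigVG F M),
  [/\ (* F[Z_M] = S / I(Z_M), by evaluation *)
      alg_iso ev
        /\ (forall f z, ev (coord_class Z f) z = coord_eval f (val z)),
      (* S / I(Z_M) is isomorphic to the big VG ring *)
      [/\ alg_iso phi,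
          forall i, phi (coord_class Z (coordinate F (i, Some true))) = heaviside F M i true,
          forall i, phi (coord_class Z (coordinate F (i, Some false))) = heaviside F M i false
        & forall i, phi (coord_class Z (coordinate F (i, None)))
                    = 1 - heaviside F M i true - heaviside F M i false],
      (* phi respects the degree filtrations *)
      forall k a, a \in bigVG_fil k
        <-> exists2 f, (msize f <= k.+1)%N & a = phi (coord_class Z f)
    & (* phi induces the graded isomorphism psi *)
      [/\ alg_iso psi,
          forall k u, orbit_degree k u <-> in_summand k (psi u)
        & forall k f, f \is k.-homog ->
            psi (orbit_class Z f) = gr_hom (bigVG_filtration F M) k (phi (coord_class Z f))]].
Proof.
move=> Z.
(* The locus parametrized by itself, then by covectors. *)
have ZE z : z \in Z <-> exists w : Z, z = val w.
  by split=> [zZ|[w ->]]; [exists [` zZ]%fset | exact: valP].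
have [ev ev_iso evE] := quotalg_iso (@eval_at_scalar F _ Z val) (eval_at_ker ZE)
  (eval_at_surj val_inj).
have kerZ := eval_at_ker (@big_locusP F I M).
have [phi phi_iso phiE] := quotalg_iso (@eval_at_scalar F _ _ (@covector_family F I M)) kerZ
  (eval_at_surj (@covector_family_inj F I M)).
(* Symbols give the graded isomorphism; the ideal generated by top components of
   [vanishing Z] is [gr_vanishing Z] by definition. *)
have [psi [psi_iso psi_deg psiE]] := @gr_quotient_iso _ _ _ (bigVG_filtration F M)
  (eval_at (@covector_family F I M)) (@eval_at_scalar F _ _ _) (@bigVG_filE F I M)
  (vanishing Z) kerZ.
exists ev, phi, psi; split.
- by split=> // f z; rewrite [ev _]evE; exact: eval_atE.
- split=> // i; rewrite [phi _]phiE; [exact: eval_at_heaviside.. | exact: eval_at_zero_coordinate].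
- by move=> k a; rewrite bigVG_filE; split=> -[f fk ->]; exists f; rewrite ?[phi _]phiE.
- split=> // k f hf; rewrite [phi _]phiE; exact: psiE.
Qed.
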